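(* Let $p$ be an odd prime, $r$ a primitive root of $p$, $k\neq 2$ a positive integer, $S=\{s_{\ell,i}\colon \ell\in[k],\, i\in[p]\}$ an ordered $kp$-set of symbols with $0\notin S$, and $I$ an idempotent Latin square of order $k$ over $[k]$. Then the loop $L_{p,r}^{S,I}$ is compatible over the set of sum polynomials $$\left\{\nu^{\pi_{\alpha}}_{S_{\pi(1)},\ldots,S_{\pi(k)}}\colon\, \pi\in\mathrm{Sym}([k]),\ \alpha=(a_1,b_1,\ldots,a_k,b_k)\in\mathbb{Z}_p^{2k}\text{ with } a_\ell\neq 0 \text{ for all } \ell\in [k]\right\}.$$ More precisely, every sum polynomial $f$ in this set describes a zero sum in $S$, that is, $\sigma_f\left(L_{p,r}^{S,I}\right)=0$.
   Context: Notation: $[n]=\{1,\ldots,n\}$; $\mathrm{Sym}(X)$ is the symmetric group on $X$. For a set $X$ with $0\notin X$, $\widetilde{X}=\{x,-x\colon x\in X\}\cup\{0\}$ (formal negatives, $-(-x)=x$). Partial loops: A partial loop over $\widetilde{S}$ is a pair $(\widetilde{S},+)$ with $+$ a partial binary operation such that: (1) each equation $s+x=t$ and $x+s=t$ has at most one solution $x\in\widetilde{S}$, for all $s,t\in\widetilde{S}$; (2) $0+s=s+0=s$ for all $s\in\widetilde{S}$; (3) $s+(-s)=(-s)+s=0$ for all $s\in S$. It is a loop if each equation in (1) has exactly one solution. $\mathcal{L}(\widetilde{S})$ is the set of (Cayley tables of) partial loops over $\widetilde{S}$; $L[s,t]=s+_Lt$. If $s+t$ is undefined, write $s+t=\cdot$,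 and set $\cdot+s=s+\cdot=\cdot$. Sum polynomials: For $T\subseteq S$, a $T$-sum polynomial is a fully parenthesized non-associative, non-commutative formal sum of the variables $x_t$, $t\in T$, in some order, each appearing exactly once; its support is $T$. A sum polynomial over $S$ is a $T$-sum polynomial for some $T\subseteq S$. For an ordered set $T=\{t_1,\ldots,t_n\}$, the natural $T$-sum polynomial is $\nu_T=(\ldots((x_{t_1}+x_{t_2})+x_{t_3})+\ldots)+x_{t_n}$. $\sigma_f(L)\in\widetilde{S}\cup\{\cdot\}$ is the value obtained by replacing each $x_t$ in $f$ by $t$ and computing every sum with $+_L$. If $\rho$ is a permutation mapping the support of $f$ into $S$, $f^\rho$ is obtained from $f$ by replacing each $x_t$ by $x_{\rho(t)}$, with the same parentheses. $L$ is compatible over a set $P$ of sum polynomials if $\sigma_f(L)\in\widetilde{S}$ (i.e. is defined) for all $f\in P$, and $\sigma_f(L)=\sigma_g(L)$ for all $f,g\in P$ with equal supports. For $\ell\in[k]$ let $S_\ell=\{s_{\ell,1},\ldots,s_{\ell,p}\}$, ordered by the second index. For $\pi\in\mathrm{Sym}([k])$, $\nu_{S_{\pi(1)},\ldots,S_{\pi(k)}}=(\ldots((\nu_{S_{\pi(1)}}+\nu_{S_{\pi(2)}})+\nu_{S_{\pi(3)}})+\ldots)+\nu_{S_{\pi(k)}}$. For $\alpha=(a_1,b_1,\ldots,a_k,b_k)\in\mathbb{Z}_p^{2k}$ with all $a_\ell\neq0$, $\pi_\alpha$ is the permutation of $\widetilde{S}$ with $\pi_\alpha(0)=0$, $\pi_\alpha(-s)=-\pi_\alpha(s)$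 and $\pi_\alpha(s_{\ell,i})=s_{\ell,\,(a_\ell(i-1)+b_\ell \bmod p)+1}$, where $\bmod\ p$ takes values in $\{0,\ldots,p-1\}$. The loop $L_{p,r}\in\mathcal{L}(\widetilde{[p]})$: let $H_{p,r}[i,j]=j+\frac{i-j}{r}\in\mathbb{Z}_p$ for $i,j\in\mathbb{Z}_p$, with elements of $\mathbb{Z}_p$ represented by $0,\ldots,p-1$ and division in the field $\mathbb{Z}_p$. Then $0$ is the unity and, for $i,j\in[p]$: $L_{p,r}[i,j]=-(H_{p,r}[i-1,j-1]+1)$; $L_{p,r}[i,-j]=L_{p,r}[-i,j]=H_{p,r}[i-1,j-1]+1$ if $i\neq j$; $L_{p,r}[-i,-j]=-(H_{p,r}[i-1,j-1]+1)$ if $i\neq j$; $L_{p,r}[-i,-i]=i$; $L_{p,r}[i,-i]=L_{p,r}[-i,i]=0$. Idempotent means $I[\ell,\ell]=\ell$ for all $\ell\in[k]$. The loop $L_{p,r}^{S,I}\in\mathcal{L}(\widetilde{S})$ has unity $0$, and with the convention $s_{\ell,-i}=-s_{\ell,i}$ it is given, for $\ell_1,\ell_2\in[k]$, $i_1,i_2\in[p]$, by $L_{p,r}^{S,I}[s_{\ell_1,i_1},s_{\ell_2,i_2}]=s_{I[\ell_1,\ell_2],\,L_{p,r}[i_1,i_2]}$ always, and, when $(\ell_1,i_1)\neq(\ell_2,i_2)$, $L_{p,r}^{S,I}[-s_{\ell_1,i_1},s_{\ell_2,i_2}]=L_{p,r}^{S,I}[s_{\ell_1,i_1},-s_{\ell_2,i_2}]=-s_{I[\ell_1,\ell_2],\,L_{p,r}[i_1,i_2]}$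 and $L_{p,r}^{S,I}[-s_{\ell_1,i_1},-s_{\ell_2,i_2}]=s_{I[\ell_1,\ell_2],\,L_{p,r}[i_1,i_2]}$; finally $L_{p,r}^{S,I}[s,-s]=L_{p,r}^{S,I}[-s,s]=0$ and $L_{p,r}^{S,I}[-s,-s]=s$ for all $s\in S$. *)

(* Defs.v *)
From HB Require Import structures.
From mathcomp Require Import all_boot all_fingroup all_algebra ring.

Set Implicit Arguments.
Unset Strict Implicit.
Unset Printing Implicit Defensive.

Import GRing.Theory.

Local Open Scope ring_scope.

(* The set X together with formal negatives and a new element 0. *)
Inductive sym (X : Type) : Type := Zero | Pos of X | Neg of X.
Arguments Zero {X}.

Definition opp (X : Type) (x : sym X) : sym X :=
  match x with Zero => Zero | Pos a => Neg a | Neg a => Pos a end.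

Definition map_sym (X Y : Type) (g : X -> Y) (x : sym X) : sym Y :=
  match x with Zero => Zero | Pos a => Pos (g a) | Neg a => Neg (g a) end.

(* [None] stands for an undefined sum. *)
Record partial_loop (X : Type) : Type := PartialLoop {
  table :> sym X -> sym X -> option (sym X);
  pl_left_unique : forall s t x y : sym X,
    table s x = Some t -> table s y = Some t -> x = y;
  pl_right_unique : forall s t x y : sym X,
    table x s = Some t -> table y s = Some t -> x = y;
  pl_unit : forall s : sym X, table Zero s = Some s /\ table s Zero = Some s;
  pl_inverse : forall s : X,
    table (Pos s) (Neg s) = Some Zero /\ table (Neg s) (Pos s) = Some Zero
}.

Definition is_loop (X : Type) (L : partial_loop X) : Prop :=
  forall s t : sym X,
    (exists! x, L s x = Some t) /\ (exists! x, L x s = Some t).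

Inductive expr (X : Type) : Type := Var of X | Add of expr X & expr X.

Fixpoint leaves (X : Type) (f : expr X) : seq X :=
  match f with Var t => [:: t] | Add f1 f2 => leaves f1 ++ leaves f2 end.

Record sum_poly (X : eqType) : Type := SumPoly {
  sp_expr :> expr X;
  sp_uniq : uniq (leaves sp_expr)
}.

Definition supp (X : finType) (f : sum_poly X) : {set X} :=
  [set t in leaves f].

Fixpoint sigma (X : Type) (L : partial_loop X) (f : expr X) : option (sym X) :=
  match f with
  | Var t => Some (Pos t)
  | Add f1 f2 =>
      match sigma L f1, sigma L f2 with
      | Some x, Some y => L x y
      | _, _ => None
      end
  end.

Definition compatible (X : finType) (L : partial_loop X)
    (P : sum_poly X -> Prop) : Prop :=
  (forall f, P f -> exists x : sym X, sigma L f = Some x) /\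
  (forall f g, P f -> P g -> supp f = supp g -> sigma L f = sigma L g).

Fixpoint map_expr (X Y : Type) (g : X -> Y) (f : expr X) : expr Y :=
  match f with
  | Var t => Var (g t)
  | Add f1 f2 => Add (map_expr g f1) (map_expr g f2)
  end.

(* Only meant for [rho] sending the variables of [f] to elements of [X];
   the second branch is a dummy. *)
Definition rename (X : Type) (rho : sym X -> sym X) (f : expr X) : expr X :=
  map_expr (fun t => if rho (Pos t) is Pos t' then t' else t) f.

(* (...((f_1 + f_2) + f_3) + ...) + f_n for fs = [:: f_1; ...; f_n], n >= 1;
   the default [d] is only returned on the empty sequence. *)
Definition left_sum (X : Type) (d : expr X) (fs : seq (expr X)) : expr X :=
  foldl (@Add X) (head d fs) (behead fs).

Definition natural_sum (X : Type) (t0 : X) (ts : seq X) : expr X :=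
  left_sum (Var t0) [seq Var t | t <- ts].

(* Throughout, an index i in {1, ..., p} is encoded as the residue i - 1 in
   'F_p (p will be prime), whose enumeration is 0, 1, ..., p - 1; likewise
   l in {1, ..., k} is encoded as l - 1 in 'I_k.  The symbol s_{l,i} is the
   pair (l, i). *)
Definition symb (p k : nat) : finType := ('I_k * 'F_p)%type.

Definition nu_block (p k : nat) (l : 'I_k) : expr (symb p k) :=
  natural_sum ((l, 0) : symb p k) [seq (l, i) | i <- enum 'F_p].

Definition nu_blocks (p k : nat) (k_gt0 : (0 < k)%N) (pi : {perm 'I_k}) :
    expr (symb p k) :=
  left_sum (nu_block p (Ordinal k_gt0))
           [seq nu_block p (pi l) | l <- enum 'I_k].

Definition pi_alpha (p k : nat) (a b : 'I_k -> 'F_p) :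
    sym (symb p k) -> sym (symb p k) :=
  map_sym (fun u : symb p k => (u.1, a u.1 * u.2 + b u.1) : symb p k).

Definition nu_alpha_expr (p k : nat) (k_gt0 : (0 < k)%N) (pi : {perm 'I_k})
    (a b : 'I_k -> 'F_p) : expr (symb p k) :=
  rename (pi_alpha a b) (nu_blocks p k_gt0 pi).

Lemma leaves_left_sum (X : Type) (d : expr X) (fs : seq (expr X)) :
  fs <> [::] -> leaves (left_sum d fs) = flatten [seq leaves f | f <- fs].
Proof.
case: fs => // f fs _; rewrite /left_sum /=.
elim: fs f => [|g fs IH] f /=; first by rewrite cats0.
by rewrite IH /= catA.
Qed.

Lemma leaves_map_expr (X Y : Type) (g : X -> Y) (f : expr X) :
  leaves (map_expr g f) = map g (leaves f).
Proof. by elim: f => //= f1 -> f2 ->; rewrite map_cat. Qed.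

Lemma leaves_nu_block (p k : nat) (l : 'I_k) :
  leaves (nu_block p l) = [seq (l, i) | i <- enum 'F_p].
Proof.
rewrite /nu_block /natural_sum leaves_left_sum.
  by elim: (enum _) => //= i s ->.
by have := mem_enum 'F_p 0; case: (enum _).
Qed.

Lemma nu_alpha_uniq (p k : nat) (k_gt0 : (0 < k)%N) (pi : {perm 'I_k})
    (a b : 'I_k -> 'F_p) :
  (forall l, a l != 0) -> uniq (leaves (nu_alpha_expr k_gt0 pi a b)).
Proof.
move=> a_neq0; rewrite /nu_alpha_expr /rename leaves_map_expr map_inj_uniq.
  rewrite /nu_blocks leaves_left_sum; last first.
    by have := mem_enum 'I_k (Ordinal k_gt0); case: (enum _).
  rewrite -map_comp.
  have -> : flatten [seq (leaves (X:=symb p k) \o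
      (fun l => nu_block p (pi l))) l | l <- enum 'I_k] =
      [seq (pi l, i) | l <- enum 'I_k, i <- enum 'F_p].
    by congr flatten; apply: eq_map => l /=; rewrite leaves_nu_block.
  apply: allpairs_uniq; rewrite ?enum_uniq //.
  by move=> [l i] [m j] _ _ /= [/perm_inj-> ->].
move=> [l i] [m j] /= e; have /= lm := congr1 fst e.
have /= := congr1 snd e; rewrite -lm => /addIr/(mulfI (a_neq0 l)) -> //.
Qed.

Definition nu_alpha (p k : nat) (k_gt0 : (0 < k)%N) (pi : {perm 'I_k})
    (a b : 'I_k -> 'F_p) (a_neq0 : forall l, a l != 0) : sum_poly (symb p k) :=
  SumPoly (nu_alpha_uniq k_gt0 pi b a_neq0).

Definition nu_alpha_family (p k : nat) (k_gt0 : (0 < k)%N) :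
    sum_poly (symb p k) -> Prop :=
  fun f => exists (pi : {perm 'I_k}) (a b : 'I_k -> 'F_p)
                  (a_neq0 : forall l, a l != 0),
    f = nu_alpha k_gt0 pi b a_neq0.

Definition H_square (p : nat) (r i j : 'F_p) : 'F_p := j + (i - j) / r.

(* With the encoding of indices, H[i-1,j-1]+1 becomes [H_square r i j]. *)
Definition L_pr (p : nat) (r : 'F_p) (x y : sym 'F_p) : sym 'F_p :=
  match x, y with
  | Zero, _ => y
  | _, Zero => x
  | Pos i, Pos j => Neg (H_square r i j)
  | Pos i, Neg j | Neg i, Pos j =>
      if i == j then Zero else Pos (H_square r i j)
  | Neg i, Neg j => if i == j then Pos i else Neg (H_square r i j)
  end.

(* s_{l,x} for x in sym 'F_p, with s_{l,-i} = - s_{l,i}. *)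
Definition symb_at (p k : nat) (l : 'I_k) : sym 'F_p -> sym (symb p k) :=
  map_sym (fun i => (l, i) : symb p k).

Definition L_prSI (p k : nat) (r : 'F_p) (I : 'I_k -> 'I_k -> 'I_k)
    (x y : sym (symb p k)) : sym (symb p k) :=
  let S (u v : symb p k) :=
    symb_at (I u.1 v.1) (L_pr r (Pos u.2) (Pos v.2)) in
  match x, y with
  | Zero, _ => y
  | _, Zero => x
  | Pos u, Pos v => S u v
  | Pos u, Neg v | Neg u, Pos v => if u == v then Zero else opp (S u v)
  | Neg u, Neg v => if u == v then Pos u else S u v
  end.

Definition latin_square (k : nat) (I : 'I_k -> 'I_k -> 'I_k) : Prop :=
  forall l m : 'I_k, (exists! x, I l x = m) /\ (exists! x, I x l = m).

Definition idempotent_square (k : nat) (I : 'I_k -> 'I_k -> 'I_k) : Prop :=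
  forall l : 'I_k, I l l = l.

Section IsLoop.
Variables (p k : nat) (r : 'F_p) (I : 'I_k -> 'I_k -> 'I_k).
Hypotheses (p_pr : prime p) (p_odd : odd p) (r_prim : p.-1.-primitive_root r)
           (I_latin : latin_square I) (I_idem : idempotent_square I).

Let r_neq0 : r != 0.
Proof.
apply/eqP=> r0; have := prim_expr_order r_prim.
by rewrite r0 expr0n; case: p p_pr => [|[|n]] // _ /esym/eqP; rewrite oner_eq0.
Qed.

Let r_neq1 : r != 1.
Proof.
apply/eqP=> r1; have p1 : (p.-1 %| 1)%N.
  by rewrite (prim_order_dvd r_prim) expr1 r1.
by move: p_pr p_odd p1; case: p => [|[|[|[|n]]]] //; rewrite dvdn1.
Qed.

Let M (u v : symb p k) : symb p k := (I u.1 v.1, H_square r u.2 v.2).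

Let M_idem u : M u u = u.
Proof. by case: u => l i; rewrite /M I_idem /H_square subrr mul0r addr0. Qed.

Let M_injr u : injective (M u).
Proof.
case: u => l i [m j] [m' j'] e.
have /= eqI := congr1 fst e; have /= eqH := congr1 snd e.
have [[x [_ xP]] _] := I_latin l (I l m).
rewrite -(xP m) // -(xP m') -?eqI //; congr (_, _).
have {eqH} : (r - 1) * (j - j') = 0.
  have /eqP : (r * H_square r i j - r * H_square r i j') = 0.
    by rewrite eqH subrr.
  move=> /eqP <-; rewrite /H_square; field; exact: r_neq0.
move/eqP; rewrite mulf_eq0 => /orP[|]; last by rewrite subr_eq0 => /eqP.
by rewrite subr_eq0 (negPf r_neq1).
Qed.

Let M_injl v : injective (M^~ v).
Proof.
case: v => l i [m j] [m' j'] e.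
have /= eqI := congr1 fst e; have /= := congr1 snd e.
rewrite /H_square => /addrI/(mulIf _) eqj.
have [_ [x [_ xP]]] := I_latin l (I m l).
rewrite -(xP m) // -(xP m') -?eqI //; congr (_, _).
by apply: (@addIr _ (- i)); apply: eqj; rewrite invr_eq0.
Qed.

Let L := L_prSI r I.

Let L_E x y : L x y =
  match x, y with
  | Zero, _ => y
  | _, Zero => x
  | Pos u, Pos v => Neg (M u v)
  | Pos u, Neg v | Neg u, Pos v => if u == v then Zero else Pos (M u v)
  | Neg u, Neg v => if u == v then Pos u else Neg (M u v)
  end.
Proof. by case: x y => [|u|u] [|v|v]. Qed.

Let M_fixr u v : M u v = u -> u = v.
Proof. by rewrite -{2}(M_idem u) => /M_injr. Qed.

Let M_fixl u v : M v u = u -> u = v.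
Proof. by rewrite -{2}(M_idem u) => /M_injl. Qed.

Let Pos_inj : injective (@Pos (symb p k)).
Proof. by move=> u v; congruence. Qed.

Let Neg_inj : injective (@Neg (symb p k)).
Proof. by move=> u v; congruence. Qed.

Let L_injr s : injective (L s).
Proof.
case: s => [|u|u] [|v|v] [|w|w]; rewrite !L_E //; do 3?case: eqP => //;
  intros; try congruence;
  match goal with
  | H : Pos _ = Pos _ |- _ => move/Pos_inj: H
  | H : Neg _ = Neg _ |- _ => move/Neg_inj: H
  end;
  first [ by move/M_injr-> | by move/M_fixr=> ?; congruence
        | by move/esym/M_fixr=> ?; congruence ].
Qed.

Let L_injl s : injective (L^~ s).
Proof.
move=> v w; change (L v s = L w s -> v = w).
case: s v w => [|u|u] [|v|v] [|w|w]; rewrite !L_E //; do 3?case: eqP => //;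
  intros; subst; try congruence;
  match goal with
  | H : Pos _ = Pos _ |- _ => move/Pos_inj: H
  | H : Neg _ = Neg _ |- _ => move/Neg_inj: H
  end;
  first [ by move/M_injl-> | by move/M_fixl=> ?; congruence
        | by move/esym/M_fixl=> ?; congruence ].
Qed.

Lemma L_prSI_injr s : injective (L_prSI r I s).
Proof. exact: L_injr. Qed.

Lemma L_prSI_injl s : injective ((L_prSI r I)^~ s).
Proof. exact: L_injl. Qed.

Let tbl (x y : sym (symb p k)) : option (sym (symb p k)) := Some (L x y).

Let tbl_left_unique s t x y : tbl s x = Some t -> tbl s y = Some t -> x = y.
Proof. by move=> [<-] [] /L_injr. Qed.

Let tbl_right_unique s t x y : tbl x s = Some t -> tbl y s = Some t -> x = y.
Proof. by move=> [<-] [] /L_injl. Qed.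

Let tbl_unit s : tbl Zero s = Some s /\ tbl s Zero = Some s.
Proof. by case: s. Qed.

Let tbl_inverse u :
  tbl (Pos u) (Neg u) = Some Zero /\ tbl (Neg u) (Pos u) = Some Zero.
Proof. by rewrite /tbl !L_E eqxx. Qed.

Definition loop_prSI : partial_loop (symb p k) :=
  @PartialLoop _ (fun x y => Some (L_prSI r I x y))
    tbl_left_unique tbl_right_unique tbl_unit tbl_inverse.

End IsLoop.

Lemma sym_inj_surj (X : finType) (g : sym X -> sym X) :
  injective g -> forall y, exists x, g x = y.
Proof.
pose enc (x : sym X) : option (X + X) :=
  match x with Zero => None | Pos a => Some (inl a) | Neg a => Some (inr a) end.
pose dec (x : option (X + X)) : sym X :=
  match x with
  | None => Zero | Some (inl a) => Pos a | Some (inr a) => Neg a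
  end.
have encK : cancel enc dec by case.
have decK : cancel dec enc by case=> [[]|].
move=> g_inj y.
have : injective (enc \o g \o dec).
  exact: inj_comp (inj_comp (can_inj encK) g_inj) (can_inj decK).
move=> /injF_bij[h _ hK]; exists (dec (h (enc y))).
by apply: (can_inj encK); exact: hK.
Qed.

Lemma loop_prSI_is_loop (p k : nat) (r : 'F_p) (I : 'I_k -> 'I_k -> 'I_k)
    (p_pr : prime p) (p_odd : odd p) (r_prim : p.-1.-primitive_root r)
    (I_latin : latin_square I) (I_idem : idempotent_square I) :
  is_loop (loop_prSI p_pr p_odd r_prim I_latin I_idem).
Proof.
move=> s t; split.
  have L_inj := L_prSI_injr p_pr p_odd r_prim I_latin I_idem (s := s).
  have [x xP] := sym_inj_surj L_inj t.
  exists x; split=> /= [|y].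
    by rewrite xP.
  by move=> [yP]; apply: L_inj; rewrite xP yP.
have L_inj := L_prSI_injl p_pr r_prim I_latin I_idem (s := s).
have [x xP] := sym_inj_surj L_inj t.
exists x; split=> /= [|y].
  by rewrite xP.
by move=> [yP]; apply: L_inj; rewrite xP yP.
Qed.

(* Main.v *)
Require Import Defs.
From mathcomp Require Import all_boot all_algebra.
From mathcomp Require Import ring zify.

Set Implicit Arguments.
Unset Strict Implicit.
Unset Printing Implicit Defensive.

Import GRing.Theory.

Local Open Scope ring_scope.

(** Already each block sums to zero, and then so does any left-nested sum of
    blocks, since 0 is the unity.

    Within one block the block index never changes, because [I] is idempotent,
    so only signs and residues mod [p] matter. Moreover [H_square r] commutes
    with every affine map [x |-> a * x + b], so one may think of the block
    whose terms are 0, 1, ..., p - 1. Adding a positive element flips the sign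
    of the partial sum and replaces its residue [v] by [H_square r v n], unless
    the partial sum is the negative of the new term [n], in which case the
    result is 0. With w = 1/r the recurrence
    [v_(n+1) - (n+1) = w * (v_n - (n+1))] is solved by
    v_n = n - (w + w^2 + ... + w^n) ([H_square_block_residue]).
    Hence v_n = n + 1 exactly when 1 + w + ... + w^n = 0, that is when
    w^(n+1) = 1, which for a primitive root [r] means p - 1 | n + 1
    ([block_residue_eq_next]). So no cancellation occurs before the last term
    p - 1, where the partial sum has residue p - 1; it has received the
    odd number p - 2 of sign changes, so it is minus the last term, and the
    block sums to 0 ([sigma_block]). *)

(** * Left-nested sums *)

Lemma left_sum_rcons (X : Type) (d e f : expr X) (fs : seq (expr X)) :
  left_sum d (rcons (e :: fs) f) = Add (left_sum d (e :: fs)) f.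
Proof. by rewrite /left_sum /= foldl_rcons. Qed.

Lemma map_expr_left_sum (X Y : Type) (g : X -> Y) (d : expr X)
    (fs : seq (expr X)) :
  map_expr g (left_sum d fs) =
  left_sum (map_expr g d) [seq map_expr g f | f <- fs].
Proof. by case: fs => // f fs; rewrite /left_sum /=; elim: fs f => /=. Qed.

Lemma map_expr_natural_sum (X Y : Type) (g : X -> Y) (t : X) (ts : seq X) :
  map_expr g (natural_sum t ts) = natural_sum (g t) [seq g u | u <- ts].
Proof. by rewrite /natural_sum map_expr_left_sum -!map_comp. Qed.

Lemma natural_sum_iotaS (X : Type) (d : X) (x : nat -> X) (n : nat) :
  natural_sum d [seq x i | i <- iota 0 n.+2] =
  Add (natural_sum d [seq x i | i <- iota 0 n.+1]) (Var (x n.+1)).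
Proof.
by rewrite -(addn1 n.+1) iotaD map_cat cats1 /natural_sum map_rcons left_sum_rcons.
Qed.

Lemma sigma_add_Var (X : Type) (L : partial_loop X) (e : expr X) (x : sym X)
    (t : X) :
  sigma L e = Some x -> sigma L (Add e (Var t)) = L x (Pos t).
Proof. by move=> /= ->. Qed.

Lemma sigma_left_sum_zero (X I : Type) (L : partial_loop X) (d : expr X)
    (F : I -> expr X) (s : seq I) :
    sigma L d = Some Zero -> (forall i, sigma L (F i) = Some Zero) ->
  sigma L (left_sum d [seq F i | i <- s]) = Some Zero.
Proof.
move=> d0 F0; case: s => //= i s; rewrite /left_sum /=.
have: sigma L (F i) = Some Zero by [].
elim: s (F i) => //= j s IHs e e0; apply: IHs => /=.
by rewrite e0 F0; have [] := pl_unit L Zero.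
Qed.

(** * The residues of the partial sums of a block *)

(** Solution with v_0 = 0 of the recurrence v_(n+1) = H_square r v_n (n+1). *)
Definition block_residue (p : nat) (r : 'F_p) (n : nat) : 'F_p :=
  n%:R - \sum_(i < n) r^-1 ^+ i.+1.

(** Reduces the block permuted by [x |-> a * x + b] to the natural one. *)
Lemma H_square_affine (p : nat) (r a b i j : 'F_p) :
  H_square r (a * i + b) (a * j + b) = a * H_square r i j + b.
Proof. by rewrite /H_square; move: (r^-1) => w; ring. Qed.

Lemma block_residue_gap (p : nat) (r : 'F_p) (n : nat) :
  n.+1%:R - block_residue r n = \sum_(i < n.+1) r^-1 ^+ i.
Proof.
by rewrite /block_residue big_ord_recl -natr1 /=; under [in RHS]eq_bigr do
  rewrite /bump /= add1n; ring.
Qed.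

Lemma H_square_block_residue (p : nat) (r : 'F_p) (n : nat) :
  H_square r (block_residue r n) n.+1%:R = block_residue r n.+1.
Proof.
rewrite /H_square -[_ - n.+1%:R]opprB block_residue_gap mulNr mulr_suml.
by congr (_ - _); apply: eq_bigr => i _; rewrite exprSr.
Qed.

(** The gap is a geometric sum, equal to (w^(n+1) - 1) / (w - 1) with
    w = 1/r; oddness of [p] gives r <> 1. *)
Lemma block_residue_eq_next (p : nat) (r : 'F_p) (n : nat) :
    prime p -> odd p -> p.-1.-primitive_root r ->
  (block_residue r n == n.+1%:R) = (p.-1 %| n.+1)%N.
Proof.
move=> p_pr p_odd r_prim.
have r_neq1 : r^-1 - 1 != 0.
  rewrite subr_eq0 invr_eq1 -[r]expr1 -(prim_order_dvd r_prim) dvdn1.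
  by have := prime_gt1 p_pr; lia.
rewrite (prim_order_dvd r_prim) -invr_eq1 -exprVn -subr_eq0.
rewrite -oppr_eq0 opprB block_residue_gap.
by rewrite -[RHS]subr_eq0 subrX1 mulf_eq0 (negPf r_neq1).
Qed.

(** * Blocks are zero sums *)

Lemma enum_Fp (p : nat) :
  prime p -> enum 'F_p = [seq n%:R | n <- iota 0 p].
Proof.
move=> p_pr; rewrite -[in iota 0 p](Fp_cast p_pr) -val_enum_ord -map_comp.
by rewrite map_id_in // => x _ /=; exact: natr_Zp.
Qed.

Definition alternate (X : Type) (n : nat) (u : X) : sym X :=
  if odd n then Neg u else Pos u.

Section Block.

Variables (p k : nat) (r : 'F_p) (I : 'I_k -> 'I_k -> 'I_k).
Hypotheses (p_pr : prime p) (p_odd : odd p) (r_prim : p.-1.-primitive_root r).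
Hypotheses (I_latin : latin_square I) (I_idem : idempotent_square I).
Variables (l : 'I_k) (a b : 'F_p).
Hypothesis a_neq0 : a != 0.

Let L := loop_prSI p_pr p_odd r_prim I_latin I_idem.
Let term (x : 'F_p) : symb p k := (l, a * x + b).

Let term_eq x y : (term x == term y) = (x == y).
Proof.
by rewrite xpair_eqE eqxx (inj_eq (addIr b)) (inj_eq (mulfI a_neq0)).
Qed.

(** A positive partial sum (even [n]) never cancels against the positive next
    term; the loop then negates its value even when both residues agree. *)
Lemma alternate_add_next (n : nat) :
  L (alternate n (term (block_residue r n))) (Pos (term n.+1%:R)) =
  Some (if odd n && (p.-1 %| n.+1)%N then Zero
        else alternate n.+1 (term (block_residue r n.+1))).
Proof.
rewrite -(block_residue_eq_next _ p_pr p_odd r_prim) /alternate /=.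
case: (odd n) => /=; rewrite ?term_eq I_idem H_square_affine.
  by rewrite H_square_block_residue; case: eqP.
by rewrite H_square_block_residue.
Qed.

Lemma sigma_initial_block (d : symb p k) (n : nat) : (n < p.-1)%N ->
  sigma L (natural_sum d [seq term i%:R | i <- iota 0 n.+1]) =
  Some (alternate n (term (block_residue r n))).
Proof.
elim: n => [|n IHn] n_lt.
  by rewrite /natural_sum /left_sum /= /block_residue big_ord0 subr0.
rewrite (natural_sum_iotaS d (fun i => term i%:R)).
by rewrite (sigma_add_Var _ (IHn (ltnW n_lt))) alternate_add_next gtnNdvd // andbF.
Qed.

(** The first [p - 1] terms sum to minus the last one: [p - 2] is odd, and
    [p - 1 | n + 1] holds for the first time at [n = p - 2]. *)
Lemma sigma_block (d : symb p k) :
  sigma L (natural_sum d [seq term i | i <- enum 'F_p]) = Some Zero.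
Proof.
rewrite enum_Fp // -map_comp.
have [n p_eq] : exists n, p = n.+2.
  by exists p.-2; have := prime_gt1 p_pr; lia.
have n_odd : odd n by have := p_odd; rewrite p_eq /= negbK.
rewrite [in iota 0 p]p_eq (natural_sum_iotaS d (fun i => term i%:R)).
have n_lt : (n < p.-1)%N by rewrite p_eq.
rewrite (sigma_add_Var _ (sigma_initial_block d n_lt)) alternate_add_next.
by rewrite n_odd [in p.-1]p_eq dvdnn.
Qed.

End Block.

Theorem proposition14 (p k : nat) (r : 'F_p) (I : 'I_k -> 'I_k -> 'I_k)
    (p_pr : prime p) (p_odd : odd p)
    (r_prim : p.-1.-primitive_root r)
    (k_gt0 : (0 < k)%N) (k_neq2 : k <> 2%N)
    (I_latin : latin_square I) (I_idem : idempotent_square I) :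
  compatible (loop_prSI p_pr p_odd r_prim I_latin I_idem)
             (nu_alpha_family k_gt0) /\
  (forall f : sum_poly (symb p k), nu_alpha_family k_gt0 f ->
     sigma (loop_prSI p_pr p_odd r_prim I_latin I_idem) f = Some Zero).
Proof.
set L := loop_prSI _ _ _ _ _.
have zero_sum f : nu_alpha_family k_gt0 f -> sigma L f = Some Zero.
  case=> pi [a [b [a_neq0 ->]]] /=.
  rewrite /nu_alpha_expr /rename /nu_blocks map_expr_left_sum -map_comp.
  have block0 l : sigma L (rename (pi_alpha a b) (nu_block p l)) = Some Zero.
    rewrite /rename /nu_block map_expr_natural_sum -map_comp.
    exact: (sigma_block p_pr p_odd r_prim I_latin I_idem l (b l) (a_neq0 l)).
  by apply: sigma_left_sum_zero => [|l]; apply: block0.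
split=> //; split=> [f /zero_sum fP | f g /zero_sum -> /zero_sum -> //].
by exists Zero.
Qed.
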